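(* Let $0<\beta<1$ and let $\mu_\beta$ be the permuton which has a mass $\beta$ uniformly distributed on the band $[0,\beta]\times[0,1]$ and a mass $1-\beta$ uniformly distributed on the line segment from $(\beta,0)$ to $(1,1)$. Let $\mathcal P^n_{\mu_\beta}$ be a set of $n$ i.i.d. random points with distribution $\mu_\beta$. Then for any $\varepsilon>0$, $$\lim_{n\to+\infty}\mathbb P\left[h\left(\mathcal T\langle\mathcal P^n_{\mu_\beta}\rangle\right)\ge\frac{1-\beta}{\beta+\varepsilon}\log n\right]=1 .$$
   Context: A permuton is a probability measure on $[0,1]^2$ with uniform marginals on both axes. Binary search trees: for a finite sequence $y=(y_1,\dots,y_n)$ of distinct reals, $\mathcal T\langle y\rangle$ is the labeled rooted binary tree obtained by inserting $y_1,\dots,y_n$ successively into the empty tree: to insert a value, start at the root, move to the left child if the value is smaller than the label of the current node and to the right child if it is larger, until an empty position is reached, where a new node with this label is created. For a finite set $\mathcal P\subset\mathbb R^2$ of points with distinct $x$- and distinct $y$-coordinates, $\mathcal T\langle\mathcal P\rangle:=\mathcal T\langle y_{(1)},\dots,y_{(n)}\rangle$, where the points $(x_{(i)},y_{(i)})$ of $\mathcal P$ are ordered so that $x_{(1)}<\dots<x_{(n)}$. The height $h(\mathcal T)$ is the maximal distance (number of edges) from a leaf to the root. *)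

(* Defs.v *)
From HB Require Import structures.
From mathcomp Require Import all_boot all_order all_algebra.
From mathcomp Require Import all_classical all_reals all_analysis.
From mathcomp Require Import measurable_realfun ring lra.

Set Implicit Arguments.
Unset Strict Implicit.
Unset Printing Implicit Defensive.

Import Order.TTheory GRing.Theory Num.Theory.
Import numFieldNormedType.Exports.

Local Open Scope classical_set_scope.
Local Open Scope ring_scope.

Inductive bintree (T : Type) : Type :=
| Empty
| Node of bintree T & T & bintree T.
Arguments Empty {T}.

Section BinarySearchTree.
Context {disp : Order.disp_t} {T : orderType disp}.

Fixpoint bst_insert (x : T) (t : bintree T) : bintree T :=
  match t with
  | Empty => Node Empty x Empty
  | Node l y r =>
      if (x < y)%O then Node (bst_insert x l) y r
      else if (y < x)%O then Node l y (bst_insert x r)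
      else t (* equal labels do not occur for distinct values *)
  end.

Definition bst (s : seq T) : bintree T :=
  foldl (fun t x => bst_insert x t) Empty s.

End BinarySearchTree.

Fixpoint leaf_depths (T : Type) (t : bintree T) : seq nat :=
  match t with
  | Empty => [::]
  | Node Empty _ Empty => [:: 0%N]
  | Node l _ r => [seq k.+1 | k <- leaf_depths l ++ leaf_depths r]
  end.

Definition height (T : Type) (t : bintree T) : nat :=
  \max_(k <- leaf_depths t) k.

Section PointSets.
Context {disp : Order.disp_t} {T : orderType disp}.

Definition xle : rel (T * T) := fun p q => (p.1 <= q.1)%O.

(* A finite set of points is given by a list of its elements; the order of the
   list is irrelevant when the x-coordinates are distinct. *)
Definition bst_points (s : seq (T * T)) : bintree T :=
  bst [seq p.2 | p <- sort xle s].

Lemma perm_bst_points (s1 s2 : seq (T * T)) :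
  uniq [seq p.1 | p <- s1] -> perm_eq s1 s2 -> bst_points s1 = bst_points s2.
Proof.
move=> us s12; rewrite /bst_points; congr (bst (map _ _)).
have tot : total xle by move=> p q; exact: le_total.
have tr : transitive xle by move=> p q r; exact: le_trans.
apply: (@sorted_eq_in _ xle).
- by move=> p q r _ _ _; exact: tr.
- move=> p q; rewrite !mem_sort => ps qs /le_anti pq.
  apply/eqP; rewrite -(nth_index p ps) -(nth_index p qs).
  rewrite (nth_uniq p _ _ (map_uniq us)) ?index_mem//.
  rewrite -(nth_uniq p.1 _ _ us) ?size_map ?index_mem//.
  by rewrite !(nth_map p) ?index_mem// !nth_index// pq.
- exact: sort_sorted.
- exact: sort_sorted.
- by rewrite perm_sort perm_sym perm_sort perm_sym.
Qed.

End PointSets.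

Section Probability.
Local Open Scope ereal_scope.
Context d d' (T : measurableType d) (U : measurableType d') (R : realType).
Context (P : probability T R) (I : finType) (X : I -> {RV P >-> U}).

Definition mutually_independent : Prop :=
  forall (J : {set I}) (A : I -> set U), (forall i, measurable (A i)) ->
    P (\bigcap_(i in [set` J]) (X i @^-1` A i)) =
    \prod_(i in J) P (X i @^-1` A i).

Definition iid (mu : set U -> \bar R) : Prop :=
  (forall i A, measurable A -> distribution P (X i) A = mu A) /\
  mutually_independent.
End Probability.

(* R^2 with its Borel sigma-algebra *)
Notation plane R := (measurableTypeR R * measurableTypeR R)%type.

Section Permuton.
Context {R : realType}.

Definition is_permuton (mu : probability (plane R) R) : Prop :=
  mu (`[0, 1] `*` `[0, 1]) = 1%E /\
  (forall A : set (measurableTypeR R), measurable A ->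
     pushforward mu fst A = uniform_prob ltr01 A) /\
  (forall A : set (measurableTypeR R), measurable A ->
     pushforward mu snd A = uniform_prob ltr01 A).

Definition segment (p q : plane R) (t : measurableTypeR R) : plane R :=
  (p.1 + t * (q.1 - p.1), p.2 + t * (q.2 - p.2)).

Lemma measurable_segment p q : measurable_fun setT (segment p q).
Proof.
by apply/measurable_fun_pairP; split => /=;
  apply: measurable_funD => //; apply: measurable_funM.
Qed.
HB.instance Definition _ p q :=
  isMeasurableFun.Build _ _ _ _ (segment p q) (measurable_segment p q).

Definition uniform_segment (p q : plane R) : set (plane R) -> \bar R :=
  distribution (uniform_prob (@ltr01 R))
    (segment p q : {mfun measurableTypeR R >-> plane R}).
HB.instance Definition _ p q := Probability.on (uniform_segment p q).

Definition uniform_rectangle (a b c e : R) (ab : a < b) (ce : c < e)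
    : set (plane R) -> \bar R := (uniform_prob ab \x uniform_prob ce)%E.

HB.instance Definition _ a b c e ab ce :=
  Probability.on (@uniform_rectangle a b c e ab ce).

Section MuBeta.
Variables (b : R) (b0 : 0 < b) (b1 : b < 1).

Let onemb_gt0 : 0 < 1 - b. Proof. by rewrite subr_gt0. Qed.

Definition mu_beta : set (plane R) -> \bar R :=
  measure_add
    (mscale (NngNum (ltW b0)) (uniform_rectangle b0 (@ltr01 R)))
    (mscale (NngNum (ltW onemb_gt0)) (uniform_segment (b, 0) (1, 1))).

HB.instance Definition _ := Measure.on mu_beta.

Let mu_beta_setT : mu_beta [set: _] = 1%E.
Proof.
have rT : uniform_rectangle b0 (@ltr01 R) [set: _] = 1%E.
  exact: probability_setT.
have sT : uniform_segment (b, 0) (1, 1) [set: _] = 1%E.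
  exact: probability_setT.
rewrite /mu_beta measure_addE.
transitivity (b%:E * uniform_rectangle b0 (@ltr01 R) [set: _] +
   (1 - b)%:E * uniform_segment (b, 0%R) (1%R, 1%R) [set: _])%E => //.
rewrite rT sT !mule1 -EFinD.
by rewrite addrC subrK.
Qed.

HB.instance Definition _ :=
  Measure_isProbability.Build _ _ _ mu_beta mu_beta_setT.

Lemma mu_betaE A : mu_beta A =
  (b%:E * uniform_rectangle b0 (@ltr01 R) A +
   (1 - b)%:E * uniform_segment (b, 0%R) (1%R, 1%R) A)%E.
Proof. by rewrite /mu_beta measure_addE. Qed.

End MuBeta.

Lemma uniform_prob_ray (a b r : R) (ab : a < b) :
  uniform_prob ab `]r, +oo[ =
  ((b - Num.max a (Num.min b r)) / (b - a))%:E.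
Proof.
rewrite /uniform_prob integral_uniform_pdf.
rewrite (eq_integral (fun=> ((b - a)^-1)%:E)); last first.
  move=> x; rewrite inE/= => -[_]; rewrite in_itv/= => axb.
  by rewrite /uniform_pdf axb.
rewrite integral_cst//=; last exact: measurableI.
rewrite [RHS]EFinM muleC; congr (_ * _)%E.
have [ra|ar] := ltP r a.
  rewrite (_ : _ `&` _ = `[a, b]%classic); last first.
    apply/seteqP; split => x /=; rewrite !in_itv/= ?andbT; first by case.
    by move=> /andP[ax xb]; split; [lra|apply/andP].
  rewrite lebesgue_measure_itv/= lte_fin ab -EFinB; congr (_%:E).
  by rewrite min_r ?max_l //; lra.
rewrite (_ : _ `&` _ = `]r, b]%classic); last first.
  apply/seteqP; split => x /=; rewrite !in_itv/= ?andbT.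
    by move=> [-> /andP[]].
  by move=> /andP[rx ->]; split => //; rewrite andbT; lra.
rewrite lebesgue_measure_itv/= lte_fin; case: ltP => rb.
  by rewrite -EFinB max_r.
by rewrite max_r ?subrr// ltW.
Qed.

Lemma eq_measure_ray (m1 m2 : {measure set (measurableTypeR R) -> \bar R}) :
  (m1 setT < +oo)%E ->
  (forall r, m1 `]r, +oo[%classic = m2 `]r, +oo[%classic) ->
  forall A, measurable A -> m1 A = m2 A.
Proof.
move=> m1oo m12.
apply: (@measure_unique _ R (measurableTypeR R) (@RGenOInfty.G R)
    (fun k => `](- k%:R), +oo[%classic) _ _ _ _ m1 m2).
- exact: RGenOInfty.measurableE.
- move=> _ _ [x ->] [y ->]; exists (Num.max x y).
  apply/seteqP; split => z /=; rewrite !in_itv/= !andbT gt_max.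
    by move=> [-> ->].
  by move=> /andP[].
- by move=> k; exists (- k%:R).
- apply/seteqP; split => // x _; exists (Num.truncn `|x|).+1 => //=.
  rewrite in_itv/= andbT ltrNl (le_lt_trans (ler_norm _))// normrN.
  exact: truncnS_gt.
- by move=> _ [x ->].
- by move=> k; apply: le_lt_trans m1oo; apply: le_measure => //; rewrite inE.
Qed.

Let fstR : plane R -> measurableTypeR R := fst.

#[local] HB.instance Definition _ :=
  isMeasurableFun.Build _ _ _ _ fstR measurable_fst.

Lemma mu_beta_permuton (b : R) (b0 : 0 < b) (b1 : b < 1) :
  is_permuton (mu_beta b0 b1).
Proof.
have u1 (a c : R) (ac : a < c) (A : set (measurableTypeR R)) :
    `[a, c] `<=` A -> uniform_prob ac A = 1%E.
  by move=> acA; rewrite /uniform_prob integral_uniform_pdf1.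
split; [|split].
- rewrite [LHS]mu_betaE.
  have -> : uniform_rectangle b0 (@ltr01 R) (`[0, 1] `*` `[0, 1]) = 1%E.
    transitivity (uniform_prob b0 `[0%R, 1%R] * uniform_prob (@ltr01 R) `[0%R, 1%R])%E.
      exact: product_measure1E.
    rewrite !u1 ?mule1//.
    by apply: subset_itvl; rewrite bnd_simp ltW.
  have -> : uniform_segment (b, 0) (1, 1) (`[0, 1] `*` `[0, 1]) = 1%E.
    apply: u1 => t /=; rewrite !in_itv/= => /andP[t0 t1].
    by split; apply/andP; split; nra.
  by rewrite !mule1 -EFinD addrC subrK.
- apply: (@eq_measure_ray (distribution (mu_beta b0 b1)
      (fstR : {mfun plane R >-> measurableTypeR R}))
    (uniform_prob (@ltr01 R))).
    by rewrite [ltLHS](_ : _ = 1%E) ?ltry//; exact: probability_setT.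
  move=> r; rewrite /distribution /pushforward [LHS]mu_betaE.
  have -> : uniform_rectangle b0 (@ltr01 R) (fst @^-1` `]r, +oo[) =
      uniform_prob b0 `]r, +oo[.
    transitivity (uniform_prob b0 `]r, +oo[ *
                  uniform_prob (@ltr01 R) [set: measurableTypeR R])%E.
      have -> : fst @^-1` `]r, +oo[ =
          `]r, +oo[ `*` [set: measurableTypeR R] :> set (plane R).
        by apply/seteqP; split => -[x y] //= [].
      exact: product_measure1E.
    by rewrite [X in (_ * X)%E]u1 ?mule1.
  have -> : uniform_segment (b, 0) (1, 1) (fst @^-1` `]r, +oo[) =
      uniform_prob (@ltr01 R) `]((r - b) / (1 - b)), +oo[.
    congr uniform_prob; apply/seteqP; split => t /=; rewrite !in_itv/= !andbT.
      by rewrite ltr_pdivrMr ?subr_gt0//; lra.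
    by rewrite ltr_pdivrMr ?subr_gt0//; lra.
  rewrite !uniform_prob_ray [RHS]uniform_prob_ray -!EFinM -EFinD; congr (_%:E).
  have bE x : b * (x / (b - 0)) = x by rewrite subr0 mulrC divfK// gt_eqF.
  rewrite bE subr0 !divr1; set s := (r - b) / (1 - b).
  have rE : r = b + s * (1 - b) by rewrite divfK ?subr_eq0 ?gt_eqF//; lra.
  clearbody s; have [s0|s0] := leP s 0.
    have rb : r <= b by rewrite rE; nra.
    rewrite (min_r rb) (min_r (_ : r <= 1)); last by lra.
    rewrite (min_r (_ : s <= 1)); last by lra.
    by rewrite (max_l s0); ring.
  have [s1|s1] := leP s 1.
    have br : b <= r by rewrite rE; nra.
    have r1 : r <= 1 by rewrite rE; nra.
    rewrite (min_l br) (min_r r1) (max_r (ltW b0)) (max_r (ltW s0)).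
    by rewrite max_r ?rE; [ring|nra].
  have r1 : 1 <= r by rewrite rE; nra.
  rewrite (min_l r1) (min_l (_ : b <= r)); last by lra.
  by rewrite (max_r (ltW b0)) (max_r ler01); ring.
- move=> A mA; rewrite /pushforward [LHS]mu_betaE.
  have -> : uniform_rectangle b0 (@ltr01 R) (snd @^-1` A) =
      uniform_prob (@ltr01 R) A.
    transitivity (uniform_prob b0 [set: measurableTypeR R] *
                  uniform_prob (@ltr01 R) A)%E.
      have -> : snd @^-1` A = [set: measurableTypeR R] `*` A :> set (plane R).
        by apply/seteqP; split => -[x y] //= [].
      exact: product_measure1E.
    by rewrite [X in (X * _)%E]u1 ?mul1e.
  have -> : uniform_segment (b, 0) (1, 1) (snd @^-1` A) =
      uniform_prob (@ltr01 R) A.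
    congr uniform_prob; apply/funext => t /=.
    by rewrite add0r subr0 mulr1.
  by rewrite -ge0_muleDl ?lee_fin ?subr_ge0 ?ltW// -EFinD addrC subrK mul1e.
Qed.

End Permuton.

(* Main.v *)
Require Import Defs.
From HB Require Import structures.
From mathcomp Require Import all_boot all_order all_algebra.
From mathcomp Require Import all_classical all_reals all_analysis.
From mathcomp Require Import measurable_realfun ring lra.

(* Both parts of the permuton have a uniform y-marginal, so, reading the n
   points by increasing y, the labels "segment" (probability q = 1 - beta) and
   "band" are i.i.d. and independent of the y-coordinates.  Segment points which
   are consecutive in the y-order are inserted in increasing order and so lie on
   a single branch of the tree; hence a run of k labels "segment" forces height at
   least k - 1.  Cutting the labels into n %/ k disjoint blocks, such a run is
   missing with probability at most (1 - q ^ k) ^ (n %/ k), and this tends to 0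
   for k of order C ln n as soon as n q ^ (C ln n) grows like a power of n.
   Independence is used only through finite sums: the y-axis is cut into m
   cells, the y-order is that of the cells when these are distinct, and m is
   then made large for fixed n. *)

Set Implicit Arguments.
Unset Strict Implicit.
Unset Printing Implicit Defensive.

Import Order.TTheory GRing.Theory Num.Theory.
Import numFieldNormedType.Exports.

Local Open Scope ring_scope.

(** * Height counted in nodes *)

Fixpoint nheight (T : Type) (t : bintree T) : nat :=
  if t is Node l _ r then (maxn (nheight l) (nheight r)).+1 else 0%N.

Lemma bigmax_map_succn (s : seq nat) : s <> [::] ->
  (\max_(k <- [seq k.+1 | k <- s]) k = (\max_(k <- s) k).+1)%N.
Proof.
elim: s => // a [|b s] IH _; first by rewrite /= !big_seq1.
by rewrite map_cons big_cons IH// [in RHS]big_cons maxnSS.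
Qed.

Lemma leaf_depths_neq0 (T : Type) (t : bintree T) :
  t <> Defs.Empty -> leaf_depths t <> [::].
Proof.
have cat0 (s1 s2 : seq nat) : s1 <> [::] \/ s2 <> [::] ->
    [seq k.+1 | k <- s1 ++ s2] <> [::].
  by case: s1 => [|? ?]; case: s2 => [|? ?] //= -[].
elim: t => // -[|l1 x1 r1] IHl x [|l2 x2 r2] IHr _ //.
- by apply: cat0; right; exact: IHr.
- by apply: cat0; left; exact: IHl.
- by apply: cat0; left; exact: IHl.
Qed.

(** Counting nodes removes the special case of leaves. The truncated predecessor gives 0 on the
    empty tree, as does the maximum over no leaves. *)
Lemma heightE (T : Type) (t : bintree T) : height t = (nheight t).-1.
Proof.
rewrite /height; elim: t => [|[|l1 x1 r1] IHl x [|l2 x2 r2] IHr];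
  rewrite ?big_nil ?big_seq1//.
- rewrite -[leaf_depths _]/[seq k.+1 | k <- leaf_depths (Node l2 x2 r2)].
  by rewrite bigmax_map_succn ?IHr ?max0n//; exact: leaf_depths_neq0.
- rewrite -[leaf_depths _]/
    [seq k.+1 | k <- leaf_depths (Node l1 x1 r1) ++ [::]].
  by rewrite cats0 bigmax_map_succn ?IHl ?maxn0//; exact: leaf_depths_neq0.
- rewrite -[leaf_depths _]/[seq k.+1 | k <-
    leaf_depths (Node l1 x1 r1) ++ leaf_depths (Node l2 x2 r2)].
  rewrite bigmax_map_succn.
    by rewrite big_cat IHl IHr /= maxnSS.
  have: leaf_depths (Node l1 x1 r1) <> [::] by exact: leaf_depths_neq0.
  by case: (leaf_depths (Node l1 x1 r1)).
Qed.

(** * Runs of increasing points in a binary search tree *)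

Section BinarySearchTree.
Context {disp : Order.disp_t} {T : orderType disp}.

(** The first value stays at the root and each later one is routed by a single comparison with it,
    so either side receives its values in their original order. *)
Lemma bst_cons (x : T) (s : seq T) :
  bst (x :: s) =
  Node (bst [seq y <- s | (y < x)%O]) x (bst [seq y <- s | (x < y)%O]).
Proof.
elim/last_ind: s => // s y IH.
rewrite -rcons_cons !filter_rcons /bst -!cats1 foldl_cat/=.
rewrite -[foldl _ _ s]/(bst (x :: s)) IH /=.
by case: ltgtP => // _; rewrite -?cats1 ?foldl_cat.
Qed.

(* The elements of an increasing value-interval are inserted along one branch:
   the first of them is their minimum, so the others go to its right subtree. *)
Lemma nheight_bst_run (a : pred T) (s : seq T) :
  (forall y, y \in s -> ~~ a y ->
     {in seq.filter a s, forall z, y < z}%O \/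
     {in seq.filter a s, forall z, z < y}%O) ->
  sorted <%O (seq.filter a s) ->
  (size (seq.filter a s) <= nheight (bst s))%N.
Proof.
have [n] := ubnP (size s); elim: n s => // n IH [//|x s] szs Ha sa.
have filtC p : seq.filter a (seq.filter p s) = seq.filter p (seq.filter a s).
  by rewrite -!filter_predI; apply: eq_filter => y /=; rewrite andbC.
have sas : sorted <%O (seq.filter a s).
  by move: sa => /=; case: ifP => // _; exact: path_sorted.
have IHf (p : pred T) :
    (size (seq.filter p (seq.filter a s)) <= nheight (bst (seq.filter p s)))%N.
  rewrite -filtC; apply: IH.
  - by rewrite size_filter (leq_ltn_trans (count_size _ _)).
  - move=> y; rewrite mem_filter => /andP[_ ys] ay.
    have [] := Ha y; rewrite ?inE ?ys ?orbT// => H; [left|right] => z;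
    by rewrite !mem_filter => /and3P[az _ zs]; apply: H;
       rewrite mem_filter az inE zs orbT.
  - by rewrite filtC; exact: sorted_filter lt_trans _ _ sas.
rewrite bst_cons /=; case: ifPn => ax /=.
  rewrite ltnS (leq_trans _ (leq_maxr _ _))//.
  rewrite (leq_trans _ (IHf _))// (_ : seq.filter _ (seq.filter a s) = seq.filter a s)//.
  apply/all_filterP; move: sa; rewrite /= ax /= => sa.
  by have := order_path_min lt_trans sa.
rewrite ltnW// ltnS.
(* A root outside the interval has all marked values on one side of it, so they pass together into
   one subtree. *)
have [] := Ha x; rewrite ?inE ?eqxx//= (negPf ax) => H.
  rewrite (leq_trans _ (leq_maxr _ _))// (leq_trans _ (IHf _))//.
  by rewrite (_ : seq.filter _ (seq.filter a s) = seq.filter a s)//; apply/all_filterP/allP.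
rewrite (leq_trans _ (leq_maxl _ _))// (leq_trans _ (IHf _))//.
by rewrite (_ : seq.filter _ (seq.filter a s) = seq.filter a s)//; apply/all_filterP/allP.
Qed.

(** Insertion uses labels only through comparisons, so the shape of the tree depends on their order
    pattern alone. *)
Lemma eq_nheight_bst (I : eqType) (f g : I -> T) (s : seq I) :
  {in s &, forall i j, (f i < f j)%O = (g i < g j)%O} ->
  nheight (bst (map f s)) = nheight (bst (map g s)).
Proof.
have [n] := ubnP (size s); elim: n s => // n IH [//|x s] szs fg.
rewrite !map_cons !bst_cons /= !filter_map.
rewrite (@eq_in_filter _ _ (preim g (fun y => y < g x)%O)); last first.
  by move=> y ys /=; rewrite fg ?inE ?eqxx ?ys ?orbT.
rewrite (@eq_in_filter _ (preim f (fun y => f x < y)%O)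
  (preim g (fun y => g x < y)%O)); last first.
  by move=> y ys /=; rewrite fg ?inE ?eqxx ?ys ?orbT.
by rewrite !IH//; try (by rewrite size_filter (leq_ltn_trans (count_size _ _)));
  move=> i j; rewrite !mem_filter => /andP[_ si] /andP[_ sj];
  rewrite fg// inE ?si ?sj orbT.
Qed.

Lemma bst_points_map (I : eqType) (f : I -> T * T) (s : seq I) :
  bst_points (map f s) =
  bst [seq (f i).2 | i <- sort (fun i j => (f i).1 <= (f j).1)%O s].
Proof. by rewrite /bst_points sort_map -map_comp. Qed.

Lemma eq_height_bst_points (I : eqType) (f g : I -> T * T) (s : seq I) :
  (forall i j, ((f i).1 <= (f j).1)%O = ((g i).1 <= (g j).1)%O) ->
  (forall i j, ((f i).2 < (f j).2)%O = ((g i).2 < (g j).2)%O) ->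
  height (bst_points (map f s)) = height (bst_points (map g s)).
Proof.
move=> fg1 fg2; rewrite !heightE !bst_points_map; congr _.-1.
have -> : (fun i j => (f i).1 <= (f j).1)%O = (fun i j => (g i).1 <= (g j).1)%O.
  by apply/funext => i; apply/funext => j; exact: fg1.
by apply: eq_nheight_bst => i j _ _; exact: fg2.
Qed.

Lemma height_bst_points_run (I : finType) (f : I -> T * T) (B : {set I}) :
  {in B &, forall i j,
     ((f i).1 <= (f j).1)%O -> i != j -> ((f i).2 < (f j).2)%O} ->
  (forall i, i \notin B ->
     {in B, forall j, (f i).2 < (f j).2}%O \/
     {in B, forall j, (f j).2 < (f i).2}%O) ->
  (#|B| <= (height (bst_points [seq f i | i <- enum I])).+1)%N.
Proof.
move=> incB intB; set t := bst_points _.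
suff : (#|B| <= nheight t)%N
  by rewrite heightE; case: (nheight t) => //; rewrite leqn0 => /eqP ->.
rewrite /t bst_points_map; set s := sort _ _.
have injB : {in B &, injective (fun i => (f i).2)}.
  move=> i j iB jB fij; apply/eqP/negPn/negP => ij.
  have /orP[fle|fle] := le_total (f i).1 (f j).1.
    by have := incB _ _ iB jB fle ij; rewrite fij ltxx.
  by have := incB _ _ jB iB fle; rewrite eq_sym fij ltxx => /(_ ij).
(* [nheight_bst_run] marks labels, not indices; by [intB] no index outside [B] shares its label with
   one inside. *)
pose a y := y \in [seq (f i).2 | i <- enum B].
have aE i : a (f i).2 = (i \in B).
  apply/mapP/idP => [[j]|iB]; last by exists i; rewrite ?mem_enum.
  rewrite mem_enum => jB fij; apply: contraT => iB.
  by case: (intB _ iB) => /(_ j jB); rewrite fij ltxx.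
have fa : seq.filter a [seq (f i).2 | i <- s] = [seq (f i).2 | i <- s & i \in B].
  by rewrite filter_map; congr map; apply: eq_filter => i; exact: aE.
have szB : size [seq i <- s | i \in B] = #|B|.
  rewrite size_filter (permP (permEl (perm_sort _ _))) -size_filter.
  rewrite cardE /enum_mem -filter_predI; congr size.
  by apply: eq_filter => i; rewrite /= andbT.
rewrite -szB -(size_map (fun i => (f i).2)) -fa.
apply: nheight_bst_run => [_ /mapP[i _ ->]|].
  rewrite aE fa => /intB[] H; [left|right] => _ /mapP[j + ->];
  by rewrite mem_filter => /andP[jB _]; exact: H.
rewrite fa sorted_map.
apply: pairwise_sorted.
have us : uniq [seq i <- s | i \in B].
  by rewrite filter_uniq// sort_uniq enum_uniq.
have ps : pairwise (fun i j => (f i).1 <= (f j).1)%O [seq i <- s | i \in B].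
  have trf : transitive (fun i j => (f i).1 <= (f j).1)%O.
    by move=> j i k; exact: le_trans.
  rewrite -sorted_pairwise// sorted_filter// sort_sorted// => i j.
  exact: le_total.
move: us; rewrite uniq_pairwise => us.
(* Sortedness in x and distinctness of indices, combined pairwise, supply the two premises of
   [incB]. *)
have := pairwise_relI (fun i j => (f i).1 <= (f j).1)%O (fun i j => i != j).
move=> /(_ [seq i <- s | i \in B]); rewrite ps us /=.
apply: (@sub_in_pairwise _ (mem B)); last exact: filter_all.
by move=> i j iB jB /andP[]; exact: incB.
Qed.
End BinarySearchTree.

(** * Bernoulli labels and disjoint blocks *)

Section Bernoulli.
Context {R : realFieldType}.
Implicit Types (q : R) (I : finType).

Definition bern q (b : bool) : R := if b then q else 1 - q.

(* Expanding the product over blocks turns the weight of each term into a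
   product over [I] of sums over [bool]. *)
Lemma sum_bern_no_block q I (B k : nat) (h : I -> nat) :
  (forall b : 'I_B, #|[set i | h i == b]| = k) ->
  \sum_(l : {ffun I -> bool})
     (\prod_i bern q (l i)) * \prod_(b < B) (1 - \prod_(i | h i == b) (l i)%:R)
  = (1 - q ^+ k) ^+ B.
Proof.
move=> hk.
(* Inclusion-exclusion over the set [S] of blocks. *)
have expand (x : 'I_B -> R) :
    \prod_b (1 - x b) = \sum_(S : {set 'I_B}) \prod_(b in S) - x b.
  under eq_bigr do rewrite addrC.
  by rewrite bigA_distr; apply: eq_bigr => S _; rewrite [RHS]big_mkcond.
transitivity (\prod_(b < B) (1 - q ^+ k)); last by rewrite prodr_const card_ord.
rewrite expand; under eq_bigr => l _ do rewrite expand mulr_sumr.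
rewrite exchange_big; apply: eq_bigr => S _.
under eq_bigr => l _ do rewrite prodrN mulrCA.
rewrite -mulr_sumr prodrN; congr (_ * _).
pose F i (x : bool) := bern q x * \prod_(b in S | h i == b) x%:R.
transitivity (\sum_(l : {ffun I -> bool}) \prod_i F i (l i)).
  apply: eq_bigr => l _; rewrite big_split; congr (_ * _) => /=.
  exact: (exchange_big_dep predT).
rewrite -(bigA_distr_bigA F).
transitivity (\prod_i \prod_(b in S | h i == b :> nat) q).
  (* An index lies in at most one block, the one numbered [h i]. If that block is in [S], the label
     [false] is killed and [q] remains; otherwise the two weights sum to 1. *)
  apply: eq_bigr => i _; rewrite big_bool /F /=.
  have [b /andP[bS hb]|noS] := pickP (fun b : 'I_B => (b \in S) && (h i == b)).
    have uS (b' : 'I_B) : (b' \in S) && (h i == b') = (b' == b).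
      apply/andP/eqP => [[_ /eqP hb']|->//].
      by apply: val_inj; rewrite /= -hb' (eqP hb).
    by rewrite !(big_pred1 b uS) mulr1 mulr0 addr0.
  by rewrite !big_pred0// !mulr1 addrC subrK.
rewrite (exchange_big_dep (mem S))/=; last by move=> i b _ /andP[].
apply: eq_bigr => b bS; rewrite prodr_const; congr (_ ^+ _).
by rewrite -(hk b); apply: eq_card => i; rewrite !inE bS.
Qed.

Lemma sum_bern q I : \sum_(l : {ffun I -> bool}) \prod_i bern q (l i) = 1.
Proof.
rewrite -(bigA_distr_bigA (fun=> bern q)) big1// => i _.
by rewrite big_bool /= addrC subrK.
Qed.

(** The product over blocks in [sum_bern_no_block] is the indicator that no block is entirely
    [true]; this is the complementary event. *)
Lemma sum_bern_block q I (B k : nat) (h : I -> nat) :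
  (forall b : 'I_B, #|[set i | h i == b]| = k) ->
  \sum_(l : {ffun I -> bool} |
      [exists b : 'I_B, [forall i, (h i == b) ==> l i]])
     \prod_i bern q (l i) = 1 - (1 - q ^+ k) ^+ B.
Proof.
move=> hk; rewrite -(sum_bern_no_block q hk) -[X in X - _](sum_bern q I).
rewrite -sumrB big_mkcond; apply: eq_bigr => l _.
case: ifPn => [/existsP[b /forallP hb]|].
  rewrite (bigD1 b)//= [X in 1 - X]big1 ?subrr ?mul0r ?mulr0 ?subr0// => i hi.
  by have /implyP/(_ hi) -> := hb i.
move=> /existsPn nb; rewrite [X in _ * X]big1 ?mulr1 ?subrr// => b _.
have /forallPn[i] := nb b; rewrite negb_imply => /andP[hi /negPf li].
by rewrite (bigD1 i)//= li mul0r subr0.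
Qed.

(** The ratio is the probability that [n] uniform draws from [m] cells are distinct. It never
    exceeds 1, so the next factor [1 - n / m] costs at most [n / m], less than the growth of
    [n ^ 2 / m]. *)
Lemma ffact_ge n m : (0 < m)%N -> (n <= m)%N ->
  1 - n%:R ^+ 2 / m%:R <= (m ^_ n)%:R / m%:R ^+ n :> R.
Proof.
move=> m0; elim: n => [|n IH] nm.
  by rewrite ffactn0 expr0 expr2 !mul0r subr0 divr1.
have m0' : 0 < m%:R :> R by rewrite ltr0n.
rewrite ffactnSr natrM [_ ^+ n.+1]exprSr invfM mulrACA natrB; last exact: ltnW.
have := IH (ltnW nm); set u := _ / _ ^+ n => hu.
have u0 : 0 <= u by rewrite divr_ge0 ?exprn_ge0.
have u1 : u <= 1.
  rewrite ler_pdivrMr ?exprn_gt0// mul1r -natrX ler_nat.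
  rewrite ffact_prod -[X in (_ <= _ ^ X)%N]card_ord -prod_nat_const.
  by rewrite leq_prod// => i _; exact: leq_subr.
rewrite mulrBl divff ?gt_eqF//; rewrite -natr1.
have v0 : 0 <= m%:R^-1 :> R by rewrite invr_ge0.
have N0 : 0 <= n%:R :> R by [].
set v := m%:R^-1 in hu v0 *; set N := n%:R in hu N0 *.
have Nv0 : 0 <= N * v by rewrite mulr_ge0.
have : 0 <= (1 - u) * (N * v) by rewrite mulr_ge0// subr_ge0.
nra.
Qed.
End Bernoulli.

(** * Ranks and blocks of consecutive ranks *)

Section Rank.
Context {n m : nat}.
Implicit Types c : {ffun 'I_n -> 'I_m}.

(** For injective [c], this is the position, counted from 0, in the order of the cells. *)
Definition rank c (i : 'I_n) : nat := #|[set j | (c j < c i)%N]|.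

Lemma leq_rank c i j : (c i <= c j)%N -> (rank c i <= rank c j)%N.
Proof.
move=> cij; apply/subset_leq_card/fintype.subsetP => r.
by rewrite !inE => /leq_trans; exact.
Qed.

Lemma ltn_rank c i j : (rank c i < rank c j)%N -> (c i < c j)%N.
Proof. by rewrite !ltnNge; apply: contraNN; exact: leq_rank. Qed.

Lemma rank_ltn c i : (rank c i < n)%N.
Proof.
rewrite -[X in (_ < X)%N]card_ord; apply/proper_card/properP; split.
  exact/fintype.subsetP.
by exists i; rewrite // inE ltnn.
Qed.

(** For injective [c] the rank permutes ['I_n], so the block is the preimage of the positions from
    [b * k] to [b * k + k - 1]. The bound on [b] keeps these below [n] and excludes an incomplete
    last block. *)
Lemma card_rank_block c (k b : nat) :
  (0 < k)%N -> injective c -> (b < n %/ k)%N ->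
  #|[set i | (rank c i %/ k == b)%N]| = k.
Proof.
move=> k0 cinj bnk.
pose r (i : 'I_n) : 'I_n := Ordinal (rank_ltn c i).
have rinj : injective r.
  move=> i j [] rij; apply: cinj; apply/val_inj/eqP; rewrite eqn_leq.
  apply/andP; split; rewrite leqNgt; apply/negP => cij.
    suff : (rank c j < rank c i)%N by rewrite rij ltnn.
    apply/proper_card/properP; split.
      by apply/fintype.subsetP => s; rewrite !inE => /ltn_trans; exact.
    by exists j; rewrite !inE ?ltnn.
  suff : (rank c i < rank c j)%N by rewrite rij ltnn.
  apply/proper_card/properP; split.
    by apply/fintype.subsetP => s; rewrite !inE => /ltn_trans; exact.
  by exists i; rewrite !inE ?ltnn.
have bk (x : 'I_k) : (b * k + x < n)%N.
  rewrite (leq_trans _ (leq_trunc_div n k))//.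
  rewrite (leq_trans _ (leq_mul bnk (leqnn k)))//.
  by rewrite mulSn addnC ltn_add2r.
have -> : [set i | (rank c i %/ k == b)%N] =
    r @^-1: [set Ordinal (bk x) | x in 'I_k].
  apply/setP => i; rewrite !inE.
  apply/eqP/imsetP => [rib|[x _ /(congr1 val) /= ->]].
    exists (Ordinal (ltn_pmod (rank c i) k0)) => //; apply/val_inj => /=.
    by rewrite -rib -divn_eq.
  by rewrite divnMDl// divn_small// addn0.
rewrite on_card_preimset; last first.
  by apply: onW_bij; exact: injF_bij.
by rewrite card_imset ?card_ord// => x y /(congr1 val) /= /addnI /val_inj.
Qed.
End Rank.

Local Open Scope classical_set_scope.
Local Open Scope ring_scope.

(** * Cells of the plane and their masses *)

Section Cells.
Context {R : realType}.

Lemma uniform_prob01_itv (a b : R) : 0 <= a -> a <= b -> b <= 1 ->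
  uniform_prob (@ltr01 R) `]a, b] = (b - a)%:E.
Proof.
move=> a0 ab b1; rewrite /uniform_prob integral_uniform_pdf.
have -> : `]a, b] `&` `[0, 1] = `]a, b]%classic.
  by apply/setIidl => x /=; rewrite !in_itv/= => /andP[ax xb]; lra.
rewrite (eq_integral (fun=> 1%E)); last first.
  move=> x; rewrite inE/= in_itv/= => /andP[ax xb].
  by rewrite /uniform_pdf ifT ?subr0 ?invr1//; lra.
rewrite integral_cst//= mul1e lebesgue_measure_itv/= lte_fin.
case: ltP => // ba; rewrite (_ : b = a) ?subrr//; lra.
Qed.

(* [a.2 = true] marks the segment part; the strips are open below because the
   segment starts on the line [p.1 = beta]. *)
Definition cell (beta : R) (m : nat) (a : 'I_m * bool) : set (plane R) :=
  [set p : R * R | p.2 \in `](a.1%:R / m%:R), (a.1.+1%:R / m%:R)] /\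
           if a.2 then beta < p.1 /\ p.1 - (beta + p.2 * (1 - beta)) = 0
           else p.1 <= beta].

Lemma measurable_cell (beta : R) (m : nat) (a : 'I_m * bool) :
  measurable (cell beta a).
Proof.
have m1 : measurable_fun setT (fst : plane R -> measurableTypeR R).
  exact: measurable_fst.
have m2 : measurable_fun setT (snd : plane R -> measurableTypeR R).
  exact: measurable_snd.
apply: measurableI.
  rewrite -[X in measurable X]setTI.
  exact: (m2 measurableT `](a.1%:R / m%:R), (a.1.+1%:R / m%:R)]%classic).
case: a.2.
  apply: measurableI.
    rewrite -[X in measurable X]setTI.
    rewrite (_ : (fun _ => _) = fst @^-1` `]beta, +oo[); first exact: m1.
    by apply/funext => p; rewrite /= in_itv/= andbT.
  have mf : measurable_fun [set: plane R]
      (fun p : R * R => p.1 - (beta + p.2 * (1 - beta)) : R).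
    have cst (r : R) : measurable_fun [set: plane R] (fun=> r).
      exact: measurable_cst.
    exact: (measurable_funB m1
      (measurable_funD (cst beta) (measurable_funM m2 (cst (1 - beta))))).
  rewrite -[X in measurable X]setTI; exact: (mf measurableT [set 0]).
rewrite -[X in measurable X]setTI.
rewrite (_ : (fun _ => _) = fst @^-1` `]-oo, beta]); first exact: m1.
by apply/funext => p; rewrite /= in_itv.
Qed.

Lemma cell_inj (beta : R) (m : nat) (a a' : 'I_m * bool) (p : plane R) :
  cell beta a p -> cell beta a' p -> a = a'.
Proof.
case: a a' => [j l] [j' l'] [/= pj pl] [/= pj' pl'].
have m0 : 0 < m%:R :> R by rewrite ltr0n (leq_ltn_trans _ (ltn_ord j)).
congr (_, _).
  move: pj pj'; rewrite !in_itv/= => /andP[j1 j2] /andP[j1' j2'].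
  have mi : 0 < m%:R^-1 :> R by rewrite invr_gt0.
  apply/val_inj/eqP; rewrite eqn_leq.
  apply/andP; split; rewrite -ltnS -(ltr_nat R) -(ltr_pM2r mi).
    exact: lt_le_trans j1 j2'.
  exact: lt_le_trans j1' j2.
case: l l' pl pl' => [] [] //=.
  by case=> + _; rewrite ltNge => /negP.
by move=> ? [+ _]; rewrite ltNge => /negP.
Qed.

(** The component selected by the label has a uniform y-marginal, so it gives a strip the share
    [1 / m]. The other component is only bounded below by 0, hence an inequality. *)
Lemma mu_cell (beta : R) (b0 : 0 < beta) (b1 : beta < 1) m (a : 'I_m * bool) :
  ((bern (1 - beta) a.2 / m%:R)%:E <= mu_beta b0 b1 (cell beta a))%E.
Proof.
rewrite mu_betaE.
have m0 : 0 < m%:R :> R by rewrite ltr0n (leq_ltn_trans _ (ltn_ord a.1)).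
have strip : uniform_prob (@ltr01 R)
    `](a.1%:R / m%:R), (a.1.+1%:R / m%:R)] = (m%:R^-1)%:E.
  rewrite uniform_prob01_itv.
  - by rewrite -mulrBl -natrB// subSnn mul1r.
  - by rewrite divr_ge0.
  - by rewrite ler_pM2r ?invr_gt0// ler_nat.
  - by rewrite ler_pdivrMr// mul1r ler_nat.
have nneg : (0 <= beta%:E)%E /\ (0 <= (1 - beta)%:E)%E.
  by rewrite !lee_fin; split; lra.
case: nneg => beta0 beta1.
case: a strip => j [] /= strip; rewrite /bern.
  rewrite EFinM -[leLHS]add0e; apply: leeD.
    by apply: mule_ge0 => //; exact: measure_ge0.
  apply: lee_wpmul2l => //; rewrite -strip; apply: le_measure; rewrite ?inE//.
    rewrite -[X in measurable X]setTI.
    by apply: measurable_segment => //; exact: measurable_cell.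
  (* The parameter of the segment is its y-coordinate; it is positive since the strip is open below,
     which puts the point strictly to the right of [beta]. *)
  move=> t /= tj; split => /=; first by rewrite subr0 mulr1 add0r.
  have t0 : 0 < t.
    move: tj; rewrite in_itv/= => /andP[+ _].
    by apply: le_lt_trans; rewrite divr_ge0.
  by split; [nra|ring].
rewrite subKr EFinM -[leLHS]adde0; apply: leeD; last first.
  by apply: mule_ge0 => //; exact: measure_ge0.
apply: lee_wpmul2l => //; rewrite -strip.
have -> : cell beta (j, false) =
    `]-oo, beta] `*` `](j%:R / m%:R), (j.+1%:R / m%:R)].
  by apply/seteqP; split => -[x y] [] /=; rewrite !in_itv/=.
rewrite [leRHS](product_measure1E (uniform_prob b0) (uniform_prob (@ltr01 R)))//.
rewrite [X in (X * _)%E](_ : _ = 1%E) ?mul1e//.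
have u1 (A : set (measurableTypeR R)) :
    `[0, beta] `<=` A -> uniform_prob b0 A = 1%E.
  by move=> bA; rewrite /uniform_prob integral_uniform_pdf1.
by apply: u1 => x /=; rewrite !in_itv/= => /andP[].
Qed.

End Cells.

(** * The sample and its configurations of strips and labels *)

Section Sample.
Context {R : realType}.
Context {d : measure_display} {T : measurableType d} (P : probability T R).
Context (n : nat) (X : 'I_n -> {RV P >-> plane R}).

(* The height is a function of the finitely many comparisons of coordinates. *)
Lemma measurable_height_bst_points (A : set nat) :
  measurable [set w | A (height (bst_points [seq X i w : R * R | i <- enum 'I_n]))].
Proof.
pose pat (w : T) : {ffun 'I_n * 'I_n -> bool * bool} :=
  [ffun ij => (((X ij.1 w).1 : R) <= ((X ij.2 w).1 : R),
               ((X ij.1 w).2 : R) < ((X ij.2 w).2 : R))].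
pose H w := height (bst_points [seq X i w : R * R | i <- enum 'I_n]).
have HE w w' : pat w = pat w' -> H w = H w'.
  move=> /ffunP E; apply: eq_height_bst_points => i j.
    by have := E (i, j); rewrite !ffunE/= => -[].
  by have := E (i, j); rewrite !ffunE/= => -[].
have mpat (g : {ffun 'I_n * 'I_n -> bool * bool}) :
    measurable (pat @^-1` [set g]).
  rewrite (_ : _ @^-1` _ = \bigcap_(ij in [set: 'I_n * 'I_n])
     [set w | (((X ij.1 w).1 : R) <= ((X ij.2 w).1 : R)) = (g ij).1 /\
              (((X ij.1 w).2 : R) < ((X ij.2 w).2 : R)) = (g ij).2]);
    last first.
    apply/seteqP; split => w /=; first by move=> <- ij _; rewrite ffunE.
    move=> E; apply/ffunP => ij; rewrite ffunE.
    by have [-> ->] := E ij I; rewrite -surjective_pairing.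
  apply: fin_bigcap_measurable => // ij _.
  have m1 i : measurable_fun setT (fun w => (X i w).1 : R).
    by apply: measurableT_comp => //; exact: measurable_fst.
  have m2 i : measurable_fun setT (fun w => (X i w).2 : R).
    by apply: measurableT_comp => //; exact: measurable_snd.
  apply: measurableI.
    rewrite -[X in measurable X]setTI.
    exact: (measurable_fun_ler (m1 ij.1) (m1 ij.2) measurableT
      (Y := [set (g ij).1])).
  rewrite -[X in measurable X]setTI.
  exact: (measurable_fun_ltr (m2 ij.1) (m2 ij.2) measurableT
    (Y := [set (g ij).2])).
(* By [HE] each comparison pattern lies wholly inside or outside the event, and there are finitely
   many patterns. *)
rewrite (_ : [set w | _] =
    \bigcup_(g in [set g | exists2 w, pat w = g & A (H w)]) (pat @^-1` [set g])); last first.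
  apply/seteqP; split => w /=.
    by move=> Aw; exists (pat w) => //; exists w.
  by case=> _ [w' <- +] /= /HE Hw; rewrite -/(H w) Hw.
by apply: fin_bigcup_measurable => // g _; exact: mpat.
Qed.

Context (beta : R) (b0 : 0 < beta) (b1 : beta < 1).
Context (X_iid : iid X (mu_beta b0 b1)).

Definition config m : finType :=
  ({ffun 'I_n -> 'I_m} * {ffun 'I_n -> bool})%type.

Definition config_event m (cl : config m) : set T :=
  \bigcap_(i in [set` [set: 'I_n]%SET]) (X i @^-1` cell beta (cl.1 i, cl.2 i)).

Lemma measurable_config_event m (cl : config m) : measurable (config_event cl).
Proof.
apply: fin_bigcap_measurable => // i _.
rewrite -[X in measurable X]setTI.
by apply: measurable_funPT => //; exact: measurable_cell.
Qed.

Lemma config_event_inj m (cl cl' : config m) w :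
  config_event cl w -> config_event cl' w -> cl = cl'.
Proof.
move=> clw clw'; case: cl cl' clw clw' => [c l] [c' l'] clw clw'.
have E i : (c i, l i) = (c' i, l' i).
  by apply: cell_inj (clw i _) (clw' i _); rewrite /= inE.
by congr (_, _); apply/ffunP => i; have [] := E i.
Qed.

Lemma prob_config_event m (cl : config m) :
  ((m%:R ^- n * \prod_i bern (1 - beta) (cl.2 i))%:E <= P (config_event cl))%E.
Proof.
case: X_iid => Xdist Xind; rewrite /config_event Xind; last first.
  by move=> i; exact: measurable_cell.
have -> : m%:R ^- n * \prod_i bern (1 - beta) (cl.2 i) =
    \prod_(i < n) (bern (1 - beta) (cl.2 i) / m%:R).
  by rewrite big_split/= prodr_const card_ord exprVn mulrC.
set u := \prod_(i < n) _; set v := leRHS.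
(* Nonnegativity is carried along because multiplying the inequalities requires it. *)
suff : 0 <= u /\ (u%:E <= v)%E by case.
rewrite /u /v {u v}; under [X in (_ <= X)%E]eq_bigl do rewrite inE.
apply: (@big_ind2 R (\bar R) (fun x y => 0 <= x /\ (x%:E <= y)%E)).
- by split.
- move=> x1 x2 y1 y2 [x10 x12] [y10 y12]; split; first exact: mulr_ge0.
  by rewrite EFinM lee_pmul.
- move=> i _; split.
    by rewrite /bern; case: ifP => _; rewrite divr_ge0 ?subKr// ?subr_ge0 ltW.
  have := mu_cell b0 b1 (cl.1 i, cl.2 i).
  by rewrite -(Xdist i _ (measurable_cell _ _)).
Qed.

(** A block of ranks is consecutive in y, and here all its points lie on the increasing segment, so
    [height_bst_points_run] applies to it. *)
Lemma config_event_height m k (cl : config m) w : (0 < k)%N ->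
  injective cl.1 ->
  [exists b : 'I_(n %/ k), [forall i, (rank cl.1 i %/ k == b)%N ==> cl.2 i]] ->
  config_event cl w ->
  (k <= (height (bst_points [seq X i w : R * R | i <- enum 'I_n])).+1)%N.
Proof.
case: cl => c l /= k0 cinj /existsP[b /forallP bl] clw.
have Xcell i : cell beta (c i, l i) (X i w) by apply: clw; rewrite /= inE.
have lt2 i j : (c i < c j)%N -> ((X i w).2 : R) < (X j w).2.
  move=> cij; have [+ _] := Xcell i; have [+ _] := Xcell j.
  rewrite /= !in_itv/= => /andP[jlo _] /andP[_ ihi].
  apply: le_lt_trans ihi (le_lt_trans _ jlo); rewrite ler_pM2r ?ler_nat//.
  by rewrite invr_gt0 ltr0n (leq_ltn_trans _ (ltn_ord (c i))).
rewrite -(card_rank_block k0 cinj (ltn_ord b)); apply: height_bst_points_run.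
  move=> i j; rewrite !inE => ib jb le1 ij.
  have [_] := Xcell i; have [_] := Xcell j.
  have /implyP/(_ ib) -> := bl i; have /implyP/(_ jb) -> /= := bl j.
  move=> [_ ej] [_ ei].
  (* On the segment x is increasing and affine in y, so a weak x-order gives a weak y-order;
     strictness comes from the cells being distinct. *)
  have seg (x y x' y' : R) : x - (beta + y * (1 - beta)) = 0 ->
      x' - (beta + y' * (1 - beta)) = 0 -> x <= x' -> y <= y'.
    by move=> e e' le; rewrite -(@ler_pM2r _ (1 - beta)) ?subr_gt0//; lra.
  have le2 : ((X i w).2 : R) <= (X j w).2 := seg _ _ _ _ ei ej le1.
  have [/lt2//|/lt2|/val_inj/cinj cij] := ltngtP (c i) (c j).
    by move=> /(le_lt_trans le2); rewrite ltxx.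
  by rewrite cij eqxx in ij.
move=> i; rewrite inE => ib.
(* A rank outside block [b] is either below [b * k] or at least [b.+1 * k]. *)
have [rib|] := ltnP (rank c i) (b * k).
  left => j; rewrite inE => /eqP jb; apply/lt2/ltn_rank/(leq_trans rib).
  by rewrite -jb leq_trunc_div.
move=> bri; right => j; rewrite inE => /eqP jb; apply/lt2/ltn_rank.
have : (b.+1 * k <= rank c i)%N.
  by rewrite -leq_divRL// ltn_neqAle eq_sym ib /= leq_divRL.
by apply: leq_trans; rewrite -jb ltn_ceil.
Qed.

(** The good configurations are disjoint events, so their probabilities add up. The first factor
    accounts for distinct cells, the second for a block labelled entirely [true]. *)
Lemma prob_height_ge m k : (0 < k)%N -> (0 < m)%N -> (n <= m)%N ->
  (((1 - n%:R ^+ 2 / m%:R) * (1 - (1 - (1 - beta) ^+ k) ^+ (n %/ k)))%:E <=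
   P [set w | (k <= (height (bst_points
        [seq X i w : R * R | i <- enum 'I_n])).+1)%N])%E.
Proof.
move=> k0 m0 nm.
pose G := [pred cl : config m | injectiveb cl.1 &&
  [exists b : 'I_(n %/ k), [forall i, (rank cl.1 i %/ k == b)%N ==> cl.2 i]]].
have GP : (\sum_(cl | G cl) P (config_event cl) <=
   P [set w | (k <= (height (bst_points
        [seq X i w : R * R | i <- enum 'I_n])).+1)%N])%E.
  have -> : (\sum_(cl | G cl) P (config_event cl) =
     P (\bigcup_(cl in [set` G]) config_event cl))%E.
    rewrite measure_fin_bigcup//.
    - apply: (@bigfs _ _ _ _ (index_enum (config m))) => [|cl _].
        exact: index_enum_uniq.
      by rewrite mem_index_enum.
    - move=> cl cl' _ _ [w [clw clw']]; exact: config_event_inj clw clw'.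
    - by move=> cl _; exact: measurable_config_event.
  apply: le_measure; rewrite ?inE.
  - by apply: fin_bigcup_measurable => // cl _; exact: measurable_config_event.
  - exact: (measurable_height_bst_points [set h | (k <= h.+1)%N]).
  - move=> w [cl /= /andP[/injectiveP cinj Gb] clw].
    exact: config_event_height clw.
apply: le_trans GP.
apply: (@le_trans _ _ (\sum_(cl | G cl)
    (m%:R ^- n * \prod_i bern (1 - beta) (cl.2 i))%:E)%E); last first.
  by apply: lee_sum => cl _; exact: prob_config_event.
rewrite sumEFin lee_fin.
(* For every injective [c] the sum over labels has the same value, so the double sum is that value
   times the number of injections. *)
rewrite -(pair_big_dep (fun c : {ffun 'I_n -> 'I_m} => injectiveb c)
  (fun (c : {ffun 'I_n -> 'I_m}) (l : {ffun 'I_n -> bool}) =>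
     [exists b : 'I_(n %/ k), [forall i, (rank c i %/ k == b)%N ==> l i]])
  (fun c l => m%:R ^- n * \prod_i bern (1 - beta) (l i)))/=.
rewrite (eq_bigr (fun=> m%:R ^- n *
    (1 - (1 - (1 - beta) ^+ k) ^+ (n %/ k)))); last first.
  move=> c /injectiveP cinj; rewrite -mulr_sumr.
  rewrite (@sum_bern_block _ _ _ (n %/ k) k (fun i => rank c i %/ k)%N)// => b.
  exact: card_rank_block.
rewrite sumr_const -cardsE card_inj_ffuns !card_ord -[leRHS]mulr_natl mulrA.
apply: ler_wpM2r; last exact: ffact_ge.
have q0 : 0 <= (1 - beta) ^+ k by rewrite exprn_ge0// subr_ge0 ltW.
have q1 : (1 - beta) ^+ k <= 1 by rewrite exprn_ile1 ?subr_ge0 ?gerBl ?ltW.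
by rewrite subr_ge0 exprn_ile1 ?subr_ge0 ?gerBl.
Qed.
End Sample.

(** * Growth of the expected number of full blocks *)

Section Asymptotics.
Context {R : realType}.

(** The product [(1 - x) ^+ B * (1 + B%:R * x)] starts at 1 and does not increase with [B]. *)
Lemma expr1B_le (x : R) (B : nat) :
  0 <= x <= 1 -> (1 - x) ^+ B <= (1 + B%:R * x)^-1.
Proof.
move=> /andP[x0 x1].
have H : (1 - x) ^+ B * (1 + B%:R * x) <= 1.
  elim: B => [|B IH]; first by rewrite expr0 mul0r addr0 mulr1.
  apply: le_trans IH; rewrite exprSr -mulrA ler_wpM2l ?exprn_ge0 ?subr_ge0//.
  rewrite -natr1; have : 0 <= B%:R * x ^+ 2 by rewrite mulr_ge0// sqr_ge0.
  have : 0 <= x ^+ 2 by exact: sqr_ge0.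
  by rewrite !expr2; nra.
rewrite -[leRHS]mul1r ler_pdivlMr//.
by rewrite ltr_pwDl// mulr_ge0.
Qed.

Lemma ln_le_powR (g x : R) : 0 < g -> 0 < x -> ln x <= x `^ g / g.
Proof.
move=> g0 x0; rewrite ler_pdivlMr// mulrC -ln_powR.
have y0 : 0 < x `^ g by exact: powR_gt0.
have := @le_ln1Dx R (x `^ g - 1).
rewrite [1 + _]addrC subrK => /(_ _)/le_trans -> //.
  by lra.
by lra.
Qed.

Lemma powR_nat_dvg (g : R) : 0 < g -> (n%:R : R) `^ g @[n --> \oo] --> +oo.
Proof.
move=> g0; apply/cvgryPge => A.
have A1 : 0 < `|A| + 1 by rewrite ltr_wpDl.
near=> n.
have : (`|A| + 1) `^ g^-1 <= n%:R by near: n; exact: nbhs_infty_ger.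
move=> /(ge0_ler_powR (ltW g0)).
rewrite !nnegrE powR_ge0 => /(_ isT (ler0n _ _)).
rewrite -powRrM mulVf ?gt_eqF// powRr1 ?(ltW A1)// => H.
by apply: le_trans H; rewrite (le_trans (ler_norm A))// lerDl.
Unshelve. all: by end_near. Qed.

(* [q ^ C = exp (C ln q)] with [C = q / (beta + eps)] and
   [- ln q <= 1 / q - 1 = beta / q], so [n q ^ (C ln n)] grows like a power of
   n. *)
Lemma run_length_dvg (beta eps : R) : 0 < beta -> beta < 1 -> 0 < eps ->
  let k (n : nat) :=
    (Num.truncn ((1 - beta) / (beta + eps) * ln (n%:R : R))).+2 in
  (n %/ k n)%:R * (1 - beta) ^+ k n @[n --> \oo] --> +oo.
Proof.
move=> b0 b1 e0 k; pose q : R := 1 - beta; pose C : R := q / (beta + eps).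
have q0 : 0 < q by rewrite subr_gt0.
have be0 : 0 < beta + eps by rewrite addr_gt0.
have C0 : 0 < C by rewrite divr_gt0.
(* [q ^ (C ln n)] is at least [n ^ (- th)]; [eps > 0] makes [th < 1], leaving a positive power of
   [n]. *)
pose th : R := beta / (beta + eps).
have th1 : th < 1 by rewrite /th ltr_pdivrMr// mul1r ltrDl.
have th0 : 0 < th by rewrite divr_gt0.
have Clnq : - th <= C * ln q.
  have : - ln q <= beta / q.
    rewrite -lnV ?posrE//.
    have qV : q^-1 = 1 + beta / q.
      by rewrite -[1](@divff _ q) ?gt_eqF// -mulrDl {1}/q subrK mul1r.
    have := @le_ln1Dx R (beta / q); rewrite -qV; apply.
    by rewrite (@lt_trans _ _ 0)// ?divr_gt0// ltrN10.
  move=> H; rewrite lerNl -mulrN (le_trans (ler_wpM2l (ltW C0) H))//.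
  by rewrite /C /th mulrAC mulrCA divff ?gt_eqF// mulr1 mulrC.
(* The spare exponent [1 - th] is split in halves: one factor [n ^ g] dominates the block length,
   the other diverges. *)
pose g := (1 - th) / 2.
have g0 : 0 < g by rewrite divr_gt0// subr_gt0.
(* Chosen so that [C ln n + 2 <= D n ^ g], using [ln_le_powR] and [n ^ g >= 1]. *)
pose D := C / g + 2.
have D0 : 0 < D by rewrite addr_gt0// divr_gt0.
have : q ^+ 2 * (n%:R `^ g / D - 1) @[n --> \oo] --> +oo.
  apply/cvgryPge => A.
  have := powR_nat_dvg g0 => /cvgryPge/(_ ((A / q ^+ 2 + 1) * D)).
  apply: filterS => n; rewrite -ler_pdivlMr// -lerBrDr.
  by rewrite -[_ / q ^+ 2 <= _]/(_ <= _) ler_pdivrMr ?exprn_gt0// mulrC.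
apply: ger_cvgy; near=> n.
have n0 : (0 < n)%N by near: n; exact: nbhs_infty_gt.
have n0' : 0 < n%:R :> R by rewrite ltr0n.
have n1 : 1 <= n%:R :> R by rewrite ler1n.
have ln0 : 0 <= ln (n%:R : R) by rewrite ln_ge0.
have kup : (k n)%:R <= C * ln n%:R + 2 :> R.
  by rewrite /k -addn2 natrD lerD2r truncn_le// mulr_ge0// ltW.
(* The factor [q ^+ 2] pays for the [.+2] in [k]. *)
have qk : q ^+ 2 * n%:R `^ (- th) <= q ^+ k n.
  rewrite /k -/q -/C; set t := Num.truncn _.
  rewrite (_ : q ^+ t.+2 = q ^+ 2 * q ^+ t); last by rewrite -exprD.
  apply: ler_wpM2l; first by rewrite exprn_ge0 ?ltW.
  rewrite -powR_mulrn ?(ltW q0)// /powR !gt_eqF// ler_expR.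
  have lnq : ln q <= 0 by apply: ln_le0; rewrite /q gerBl ltW.
  have tC : t%:R <= C * ln n%:R by rewrite truncn_le// mulr_ge0// ltW.
  apply: (@le_trans _ _ (C * ln n%:R * ln q)); last by rewrite ler_wnM2r.
  by rewrite mulrAC ler_wpM2r.
have nk : n%:R / (k n)%:R - 1 <= (n %/ k n)%:R :> R.
  rewrite lerBlDr natr1 ler_pdivrMr// -natrM ler_nat ltnW//.
  by rewrite ltn_ceil.
have pge1 (x : R) : 0 <= x -> 1 <= n%:R `^ x :> R.
  by move=> x0; rewrite -[leLHS](powRr0 (n%:R : R)); exact: ler_powR.
have kD : (k n)%:R <= D * n%:R `^ g.
  apply: le_trans kup _; rewrite /D mulrDl; apply: lerD.
    by rewrite -mulrA ler_pM2l// mulrC ln_le_powR.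
  by rewrite ler_peMr// pge1// ltW.
have pth0 : 0 < n%:R `^ th :> R by rewrite powR_gt0.
have pth1 : 1 <= n%:R `^ th :> R by rewrite pge1// ltW.
have nE : n%:R = n%:R `^ g * n%:R `^ g * n%:R `^ th :> R.
  rewrite -!powRD ?(gt_eqF n0') ?implybT//.
  by rewrite -[LHS]powRr1//; congr (_ `^ _); rewrite /g; field.
have pg0 : 0 < n%:R `^ g :> R by rewrite powR_gt0.
have k0 : 0 < (k n)%:R :> R by rewrite ltr0n.
have nkge : n%:R `^ g / D * n%:R `^ th <= n%:R / (k n)%:R :> R.
  rewrite ler_pdivlMr// [leRHS]nE mulrAC ler_pM2r//.
  by rewrite -mulrA ler_pM2l// ler_pdivrMl.
apply: (@le_trans _ _ ((n%:R / (k n)%:R - 1) *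
    (q ^+ 2 * n%:R `^ (- th)))); last first.
  apply: (@le_trans _ _ ((n %/ k n)%:R * (q ^+ 2 * n%:R `^ (- th)))).
    by rewrite ler_wpM2r// mulr_ge0 ?powR_ge0 ?exprn_ge0// ltW.
  by rewrite ler_wpM2l.
rewrite mulrCA ler_wpM2l ?exprn_ge0 ?(ltW q0)// powRN.
apply: (@le_trans _ _ ((n%:R `^ g / D * n%:R `^ th - 1) * (n%:R `^ th)^-1)).
  rewrite mulrBl mulfK ?gt_eqF// lerD2l mul1r lerN2 invf_le1//.
by rewrite ler_wpM2r ?invr_ge0 ?(ltW pth0)// lerB.
Unshelve. all: by end_near. Qed.
End Asymptotics.

(** * Removing the cells and passing to the limit *)

Lemma prob_height_bst_points_ge (R : realType) (d : measure_display)
    (T : measurableType d) (P : probability T R) (n : nat)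
    (X : 'I_n -> {RV P >-> plane R}) (beta : R)
    (b0 : 0 < beta) (b1 : beta < 1) (k : nat) :
  iid X (mu_beta b0 b1) -> (0 < k)%N ->
  ((1 - (1 + (n %/ k)%:R * (1 - beta) ^+ k)^-1)%:E <=
   P [set w | (k <= (height (bst_points
        [seq X i w : R * R | i <- enum 'I_n])).+1)%N])%E.
Proof.
move=> Xiid k0; set a := (n %/ k)%:R * _; set p := P _.
have pfin : p = (fine p)%:E.
  rewrite fineK// fin_num_measure//.
  exact: (@measurable_height_bst_points _ _ _ _ _ X [set h | (k <= h.+1)%N]).
rewrite pfin lee_fin; set x := (1 - beta) ^+ k in a *.
have x01 : 0 <= x <= 1 by rewrite exprn_ge0 ?exprn_ile1 ?subr_ge0 ?gerBl ?ltW.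
have /andP[x0 x1] := x01.
set dl := (1 - x) ^+ (n %/ k).
have dl01 : 0 <= dl <= 1 by rewrite exprn_ge0 ?exprn_ile1 ?subr_ge0 ?gerBl.
have /andP[dl0 dl1] := dl01.
apply: (@le_trans _ _ (1 - dl)); first by rewrite lerB// expr1B_le.
(* The bound no longer mentions [m], so it suffices to prove it up to any [e > 0], with [m] large
   enough that the collision term [n ^ 2 / m] is at most [e]. *)
apply/ler_addgt0Pr => e e0.
pose m := (maxn n (Num.truncn (n%:R ^+ 2 / e))).+1.
have nm : (n <= m)%N by rewrite /m ltnW// ltnS leq_maxl.
have me : n%:R ^+ 2 / m%:R <= e.
  rewrite ler_pdivrMr ?ltr0n// mulrC -ler_pdivrMr//.
  by rewrite (le_trans (ltW (truncnS_gt _)))// ler_nat ltnS leq_maxr.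
have := prob_height_ge Xiid k0 (ltn0Sn _ : (0 < m)%N) nm.
rewrite -/p pfin lee_fin => H; rewrite -lerBlDr; apply: le_trans H.
rewrite mulrBl mul1r lerB//.
by rewrite (le_trans _ me)// ler_piMr ?gerBl// divr_ge0// exprn_ge0.
Qed.

Theorem proposition5p2 (R : realType)
    (beta : R) (beta_gt0 : 0 < beta) (beta_lt1 : beta < 1)
    (d : nat -> measure_display)
    (Omega : forall n, measurableType (d n))
    (P : forall n, probability (Omega n) R)
    (X : forall n, 'I_n -> {RV (P n) >-> plane R})
    (X_iid : forall n, iid (X n) (mu_beta beta_gt0 beta_lt1))
    (eps : R) (eps_gt0 : 0 < eps) :
  P n [set w | (1 - beta) / (beta + eps) * ln n%:R <=
               (height (bst_points [seq X n i w : R * R | i <- enum 'I_n]))%:R]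
    @[n --> \oo] --> 1%E.
Proof.
(* One successor makes the truncated threshold exceed the real one; the other compensates for a run
   of [k] points giving only height [k - 1]. *)
pose k (n : nat) := (Num.truncn ((1 - beta) / (beta + eps) * ln (n%:R : R))).+2.
pose a (n : nat) : R := (n %/ k n)%:R * (1 - beta) ^+ k n.
have a_dvg : a n @[n --> \oo] --> +oo.
  exact: run_length_dvg.
have a0 n : 0 <= a n by rewrite mulr_ge0// exprn_ge0// subr_ge0 ltW.
apply: (@squeeze_cvge _ _ _ _ (fun n => (1 - (1 + a n)^-1)%:E) _ (cst 1%E)).
- near=> n; apply/andP; split; last first.
    apply: probability_le1.
    exact: (@measurable_height_bst_points _ _ _ _ _ (X n) [set h | _ <= h%:R]).
  have kn0 : (0 < k n)%N by [].
  apply: le_trans (prob_height_bst_points_ge (X_iid n) kn0) _.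
  apply: le_measure; rewrite ?inE.
  + exact: (@measurable_height_bst_points _ _ _ _ _ (X n)
      [set h | (k n <= h.+1)%N]).
  + exact: (@measurable_height_bst_points _ _ _ _ _ (X n) [set h | _ <= h%:R]).
  move=> w /=; rewrite /k ltnS -(ler_nat R); apply: le_trans.
  by rewrite ltW// truncnS_gt.
- apply: cvg_EFin; first by near=> n.
  rewrite -[X in _ --> X]subr0; apply: cvgB; first exact: cvg_cst.
  apply/cvgrPdist_le => e e0; near=> n.
  rewrite sub0r normrN ger0_norm; last by rewrite invr_ge0 addr_ge0.
  rewrite -[leRHS]invrK lef_pV2 ?posrE ?invr_gt0 ?ltr_pwDl//.
  rewrite (@le_trans _ _ (a n)) ?lerDr//.
  by near: n; have /cvgryPge := a_dvg; apply.
- exact: cvg_cst.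
Unshelve. all: by end_near. Qed.
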